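(* Let $D$ be a division ring with infinite center $F$, let $n$ be a positive integer, and let $p\in F[x]$ be a nonconstant polynomial. Suppose that one of the following holds: (i) $D$ is an algebraic division ring of characteristic zero; or (ii) $D$ is finite-dimensional over $F$, $F$ has characteristic $\ell>0$, and $\ell$ divides neither $\sqrt{\dim_F D}$ nor $n$. Then $$\mathrm{M}_n(D)=Z(\mathrm{M}_n(D))+\mathrm{span}_F\{p(AB)-p(BA)\mid A,B\in\mathrm{M}_n(D)\},$$ where $Z(\mathrm{M}_n(D))$ is the center of $\mathrm{M}_n(D)$.
   Context: A division ring $D$ is algebraic if every element of $D$ is a root of a nonzero polynomial with coefficients in the center of $D$. The sum of two subsets $X+Y$ means $\{x+y\mid x\in X,\ y\in Y\}$; $\mathrm{span}_F$ denotes $F$-linear span. *)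

(* Defs.v *)
From HB Require Import structures.
From mathcomp Require Import all_boot all_order all_algebra.
Set Implicit Arguments. Unset Strict Implicit. Unset Printing Implicit Defensive.
Import Order.TTheory GRing.Theory Num.Theory.
Local Open Scope ring_scope.

(* A (possibly noncommutative) ring D is a division ring when every nonzero
   element is a unit. D : unitRingType is already nontrivial (1 != 0). *)
Definition is_division_ring (D : unitRingType) : Prop :=
  forall x : D, x != 0 -> x \is a GRing.unit.

Definition central {R : pzRingType} (x : R) : Prop :=
  forall y : R, x * y = y * x.

Definition infinite_center (D : unitRingType) : Prop :=
  ~ exists s : seq D, forall x : D, central x -> x \in s.

Definition poly_over_center (D : unitRingType) (p : {poly D}) : Prop :=
  forall i, central p`_i.

Definition peval_mx (D : unitRingType) (n : nat) (p : {poly D})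
    (X : 'M[D]_n) : 'M[D]_n :=
  \sum_(i < size p) p`_i *: X ^+ i.

Definition algebraic_division_ring (D : unitRingType) : Prop :=
  forall d : D, exists q : {poly D},
    [/\ q != 0, poly_over_center q & \sum_(i < size q) q`_i * d ^+ i = 0].

Definition center_spans (D : unitRingType) (s : seq D) : Prop :=
  forall d : D, exists c : 'I_(size s) -> D,
    (forall i, central (c i)) /\ d = \sum_(i < size s) c i * s`_i.

Definition center_free (D : unitRingType) (s : seq D) : Prop :=
  forall c : 'I_(size s) -> D, (forall i, central (c i)) ->
    \sum_(i < size s) c i * s`_i = 0 -> forall i, c i = 0.

Definition center_basis (D : unitRingType) (s : seq D) : Prop :=
  center_spans s /\ center_free s.

Definition mx_central (D : unitRingType) (n : nat) (Z : 'M[D]_n) : Prop :=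
  forall B : 'M[D]_n, Z * B = B * Z.

(* Main.v *)
(** Let [W] be a subspace of [M_n(D)] over the center [F] containing the center of [M_n(D)] and all
   [p(AB) - p(BA)]. Replacing [A] by [t A] and interpolating over the infinitely many central [t],
   [W] contains [(AB)^d - (BA)^d] with [d] the degree of [p]. The coefficient of [t] at
   [A = 1 + t X] is the commutator [[X, B^d]], so [W] contains all of these.

   Under either hypothesis every [x] in [D] has a minimal polynomial over [F] whose degree [m] is
   nonzero in [D]; in finite dimension because [m] divides [dim D = k^2]. By Wedderburn's
   factorization of this polynomial, [m x] is congruent to an element of [F] modulo [[D, D]], hence
   [D = F + [D, D]]. Moreover [1] is not a commutator: [[x, w] = 1] would give
   [q'(w) = [x, q(w)] = 0] for the minimal polynomial [q] of [w].

   If [n >= 2], then [B^d = B] for idempotents [B], and commutators with idempotents yield the matrix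
   units and all [x (E_ii - E_jj)]; what is left is the trace, which is handled by [D = F + [D, D]]
   since [n] is invertible. If [n = 1], the [d]-th powers span a Lie ideal of [D], which by Herstein's
   argument contains [[D, D]] unless all [d]-th powers are central; the latter forces [D = F] because
   [1] is not a commutator. Finally [[D, [D, D]] = [D, F + [D, D]] = [D, D]]. *)
Require Import Defs.
From HB Require Import structures.
From mathcomp Require Import all_boot all_order all_algebra all_field.
From mathcomp Require Import boolp.
Import Order.TTheory GRing.Theory Num.Theory.
Set Implicit Arguments. Unset Strict Implicit. Unset Printing Implicit Defensive.
Local Open Scope ring_scope.

(** * The center as a field, and degrees of minimal polynomials *)

Definition centralb (D : unitRingType) : {pred D} := fun x => `[< central x >].

Lemma centralP (D : unitRingType) (x : D) : reflect (central x) (x \in @centralb D).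
Proof. exact: asboolP. Qed.

Lemma centralb_divring_closed (D : unitRingType) : divring_closed (@centralb D).
Proof.
split=> [|x y /centralP cx /centralP cy|x y /centralP cx /centralP cy]; apply/centralP.
- by move=> z; rewrite mul1r mulr1.
- by move=> z; rewrite mulrBl mulrBr cx cy.
move=> z; have /commrV : GRing.comm z y by rewrite /GRing.comm cy.
by rewrite /GRing.comm -mulrA => <-; rewrite !mulrA cx.
Qed.

HB.instance Definition _ (D : unitRingType) :=
  GRing.isDivringClosed.Build D (@centralb D) (@centralb_divring_closed D).

(** The type carries the proof [hD], from which its field structure is inferred. *)
Definition center_of (D : unitRingType) (hD : is_division_ring D) :=
  {x : D | x \in @centralb D}.

Section CenterField.
Context (D : unitRingType) (hD : is_division_ring D).
Local Notation F := (center_of hD).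

HB.instance Definition _ := SubChoice.on F.
HB.instance Definition _ := [SubChoice_isSubUnitRing of F by <:].

Lemma center_of_mulC : commutative (@GRing.mul F).
Proof. by move=> x y; apply: val_inj; rewrite !rmorphM; apply: (centralP _ (valP x)). Qed.

HB.instance Definition _ := GRing.PzRing_hasCommutativeMul.Build F center_of_mulC.

Lemma center_of_fieldP : GRing.field_axiom F.
Proof.
move=> x x0; have ux : val x \is a GRing.unit.
  by apply: hD; apply: contraNneq x0 => x0; apply/eqP/val_inj.
have cV : (val x)^-1 \in @centralb D by rewrite rpredV; apply: valP.
apply/unitrP; exists (exist (fun y => y \in @centralb D) _ cV : F).
by split; apply: val_inj; rewrite rmorphM /= ?mulVr ?mulrV.
Qed.

HB.instance Definition _ := GRing.ComUnitRing_isField.Build F center_of_fieldP.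

(** A copy of [D] on which multiplication by elements of [center_of hD] is the canonical scaling. *)
Definition alg_of_center (_ : is_division_ring D) : Type := D.
Local Notation A := (alg_of_center hD).

HB.instance Definition _ := GRing.UnitRing.copy A D.

Lemma center_scaleA (a b : F) (v : A) :
  (val a * (val b * v : D) : A) = (val (a * b) * v : D).
Proof. by rewrite rmorphM mulrA. Qed.
Lemma center_scale1 (v : A) : (val (1 : F) * v : D) = v.
Proof. by rewrite rmorph1 mul1r. Qed.

HB.instance Definition _ := GRing.Zmodule_isLmodule.Build F A center_scaleA center_scale1
  (fun a => @mulrDr D (val a))
  (fun v a b => etrans (congr1 ( *%R^~ v) (rmorphD _ a b)) (@mulrDl D _ _ v)).

HB.instance Definition _ := GRing.Lmodule_isLalgebra.Build F A
  (fun a u v => @mulrA D (val a) u v).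

Lemma center_scaleAr (a : F) (u v : A) : a *: (u * v) = u * (a *: v).
Proof.
rewrite /GRing.scale /=; have ca := centralP _ (valP a).
by rewrite [LHS](@mulrA D) [RHS](@mulrA D) (ca (u : D)).
Qed.

HB.instance Definition _ := GRing.Lalgebra_isAlgebra.Build F A center_scaleAr.

Lemma scale_center (a : F) (v : A) : a *: v = (val a * v : D).
Proof. by []. Qed.

Lemma center_coords (s : seq D) : center_basis s -> vector_axiom (size s) A.
Proof.
move=> [spans_s free_s].
have coordP (d : D) : {r : 'rV[F]_(size s) | d = \sum_(i < size s) val (r 0 i) * s`_i}.
  apply: cid; have [c [cc ->]] := spans_s d.
  exists (\row_i (exist (fun y => y \in @centralb D) (c i) (introT (centralP _) (cc i)) : F)).
  by apply: eq_bigr => i _; rewrite mxE.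
pose comb (r : 'rV[F]_(size s)) : A := \sum_(i < size s) val (r 0 i) * s`_i.
have combB : {morph comb : r r' / r - r'}.
  by move=> r r'; rewrite -sumrB; apply: eq_bigr => i _; rewrite !mxE rmorphB mulrBl.
have comb_inj : injective comb.
  move=> r r' e; apply/eqP; rewrite -subr_eq0; apply/eqP/rowP => i.
  apply: val_inj; rewrite [in RHS]mxE rmorph0; move: i.
  apply: (free_s (fun i => val ((r - r') 0 i))) => [j|].
    exact/centralP/valP.
  by rewrite -[LHS]/(comb (r - r')) combB e subrr.
have combK d : comb (sval (coordP d)) = d by rewrite [RHS](svalP (coordP d)).
exists (fun d => sval (coordP d)).
  move=> a u v; apply: comb_inj; rewrite combK.
  rewrite -[in LHS](combK u) -[in LHS](combK v) scale_center mulr_sumr -big_split /=.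
  by apply: eq_bigr => i _; rewrite !mxE mulrDl mulrA.
exists comb; [exact: combK | move=> r; exact/comb_inj/combK].
Qed.

End CenterField.

(** For the least [m] with [x ^+ m] in the span [K] of the lower powers, [K] is a subalgebra of
    dimension [m]. As [L] is a division ring, so is [K], and [L] is a vector space over [K]. *)
Lemma skew_field_power_basis (F : fieldType) (L : falgType F) (x : L) :
  GRing.field_axiom L ->
  exists m (c : 'I_m -> F),
    [/\ x ^+ m = \sum_(i < m) c i *: x ^+ i,
        forall k : 'I_m -> F, \sum_(i < m) k i *: x ^+ i = 0 -> forall i, k i = 0 &
        (m %| \dim {:L})%N].
Proof.
move=> fieldL; pose X m := [seq x ^+ i | i <- iota 0 m].
have sizeX m : size (X m) == m by rewrite size_map size_iota.
have nthX m (i : 'I_m) : (X m)`_i = x ^+ i by rewrite (nth_map 0%N) ?size_iota ?nth_iota.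
have XS m : X m.+1 = rcons (X m) (x ^+ m) by rewrite /X -addn1 iotaD map_cat cats1.
have freeX m : (forall i, (i < m)%N -> x ^+ i \notin <<X i>>%VS) -> free (X m).
  elim: m => [|m IHm] notin; first by rewrite nil_free.
  have -> : free (X m.+1) = free (x ^+ m :: X m).
    by rewrite XS; apply: perm_free; rewrite perm_rcons.
  rewrite free_cons notin // IHm // => i im.
  exact/notin/ltnW.
have dep : exists m, x ^+ m \in <<X m>>%VS.
  pose N := (\dim {:L}).+1; apply/not_existsP => notin.
  have /eqP : free (X N) by apply: freeX => i _; apply/negP/notin.
  rewrite (eqP (sizeX N)) => dimX.
  by have := dimvS (subvf <<X N>>%VS); rewrite dimX ltnn.
case: (ex_minnP dep) => m xm minm; set K := <<X m>>%VS in xm.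
have frX : free (X m).
  by apply: freeX => i im; apply/negP => /minm; rewrite leqNgt im.
have memX i : (i < m)%N -> x ^+ i \in K.
  by move=> im; apply/memv_span/mapP; exists i; rewrite // mem_iota.
have m_gt0 : (0 < m)%N.
  rewrite lt0n; apply: contraTneq xm => m0.
  by rewrite /K m0 span_nil memv0 expr0 oner_eq0.
have KxS v : v \in K -> x * v \in K.
  move=> /(@coord_span _ _ _ (Tuple (sizeX m))) ->; rewrite mulr_sumr.
  apply: rpred_sum => i _; rewrite -scalerAr rpredZ //= nthX -exprS.
  by have := ltn_ord i; rewrite leq_eqVlt => /predU1P[->|/memX].
have Kpow j v : v \in K -> x ^+ j * v \in K.
  by elim: j v => [|j IHj] v Kv; rewrite ?mul1r // exprSr -mulrA; apply/IHj/KxS.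
have K1 : 1 \in K by rewrite -(expr0 x) memX.
have KK : (K * K <= K)%VS.
  apply/prodvP => u v /(@coord_span _ _ _ (Tuple (sizeX m))) -> Kv.
  rewrite mulr_suml; apply: rpred_sum => i _.
  by rewrite -scalerAl rpredZ //= nthX Kpow.
have algK : is_aspace K by rewrite /is_aspace has_algid1.
exists m, (fun i => coord (Tuple (sizeX m)) i (x ^+ m)); split.
- rewrite [LHS](@coord_span _ _ _ (Tuple (sizeX m))) //.
  by apply: eq_bigr => i _; rewrite /= nthX.
- move=> k k0; have /freeP/(_ k) := frX : free (Tuple (sizeX m)).
  by apply; rewrite -[RHS]k0; apply: eq_bigr => i _; rewrite /= nthX.
have := @skew_field_module_dimS _ _ fieldL (ASpace algK) fullv (subvf _).
by rewrite /= (eqP frX) (eqP (sizeX m)).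
Qed.

(** The coefficients are central but the type is [{poly D}], because the factors found later have
    coefficients outside the center. *)
Definition minimal_central_poly (D : unitRingType) (q : {poly D}) (x : D) : Prop :=
  [/\ q \is monic, poly_over_center q, root q x &
      forall r, poly_over_center r -> root r x -> (size r < size q)%N -> r = 0].

Lemma minimal_central_poly_dvd (D : unitRingType) (s : seq D) (x : D) :
  is_division_ring D -> center_basis s ->
  exists2 q, minimal_central_poly q x & ((size q).-1 %| size s)%N.
Proof.
move=> hD s_basis.
pose F : fieldType := center_of hD.
pose fd := Lmodule_hasFinDim.Build F (alg_of_center hD) (center_coords hD s_basis).
pose L : falgType F := HB.pack (alg_of_center hD) fd.
have [m [c [xm free_x]]] := @skew_field_power_basis F L x hD.
rewrite dimvf /= => m_dvd.
pose t : {poly D} := \poly_(i < m) (if insub i is Some j then val (c j) else 0).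
have tE (i : 'I_m) : t`_i = val (c i) by rewrite coef_poly ltn_ord valK.
have size_t : (size t < size ('X^m : {poly D}))%N by rewrite size_polyXn ltnS size_poly.
have size_q : size ('X^m - t) = m.+1 by rewrite size_polyDl ?size_polyN // size_polyXn.
exists ('X^m - t); last by rewrite size_q.
split.
- by rewrite monicE lead_coefDl ?size_polyN // lead_coefXn.
- move=> i; apply/centralP; rewrite coefB rpredB //.
    by rewrite coefXn rpred_nat.
  have [mi|im] := leqP m i; first by rewrite nth_default ?rpred0 // (leq_trans (size_poly _ _)).
  by rewrite (tE (Ordinal im)); exact: (valP (c (Ordinal im))).
- rewrite /root hornerD hornerN hornerXn horner_poly subr_eq0; apply/eqP.
  rewrite [LHS](xm : x ^+ m = _ :> D); apply: eq_bigr => i _.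
  by rewrite valK.
move=> r cr /rootP rx; rewrite size_q ltnS => size_r; apply/polyP => i; rewrite coef0.
have [mi|im] := leqP m i; first by rewrite nth_default // (leq_trans size_r).
pose k (j : 'I_m) : center_of hD :=
  exist (fun y => y \in @centralb D) r`_j (introT (centralP _) (cr j)).
suff /free_x/(_ (Ordinal im))/(congr1 val) : \sum_(i < m) k i *: (x : L) ^+ i = 0 by [].
by rewrite -[RHS]rx (horner_coef_wide _ size_r); apply: eq_bigr.
Qed.

(** * Subspaces over the center *)

(** [D] and its matrices are left [D]-modules; asking for central scalars only gives subspaces over
    the center without changing the module. *)
Definition subspace (D : unitRingType) (V : lmodType D) (W : V -> Prop) : Prop :=
  [/\ W 0, forall u v, W u -> W v -> W (u + v) &
      forall c v, central c -> W v -> W (c *: v)].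

Lemma central1 (D : pzRingType) : central (1 : D).
Proof. by move=> y; rewrite mul1r mulr1. Qed.

Lemma central0 (D : pzRingType) : central (0 : D).
Proof. by move=> y; rewrite mul0r mulr0. Qed.

Lemma centralN (D : pzRingType) (x : D) : central x -> central (- x).
Proof. by move=> cx y; rewrite mulNr mulrN cx. Qed.

Lemma centralD (D : pzRingType) (x y : D) : central x -> central y -> central (x + y).
Proof. by move=> cx cy z; rewrite mulrDl mulrDr cx cy. Qed.

Lemma centralM (D : pzRingType) (x y : D) : central x -> central y -> central (x * y).
Proof. by move=> cx cy z; rewrite -mulrA cy mulrA cx mulrA. Qed.

Lemma centralX (D : pzRingType) (x : D) k : central x -> central (x ^+ k).
Proof.
by move=> cx; elim: k => [|k IHk]; rewrite ?exprS; [apply: central1 | apply: centralM].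
Qed.

Lemma central_nat (D : pzRingType) k : central (k%:R : D).
Proof. by move=> y; rewrite mulr_natl mulr_natr. Qed.

Lemma centralV (D : unitRingType) (x : D) : central x -> central x^-1.
Proof. by move=> cx y; apply/commr_sym/commrV; rewrite /GRing.comm cx. Qed.

Section Subspace.
Context (D : unitRingType) (V : lmodType D) (W : V -> Prop) (subW : subspace W).

Lemma subspace0 : W 0. Proof. by case: subW. Qed.

Lemma subspaceD u v : W u -> W v -> W (u + v).
Proof. by case: subW => _ + _; apply. Qed.

Lemma subspaceZ c v : central c -> W v -> W (c *: v).
Proof. by case: subW => _ _; apply. Qed.

Lemma subspaceN v : W v -> W (- v).
Proof. by rewrite -scaleN1r; apply: subspaceZ; apply/centralN/central1. Qed.

Lemma subspaceB u v : W u -> W v -> W (u - v).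
Proof. by move=> Wu /subspaceN; apply: subspaceD. Qed.

Lemma subspace_sum (I : Type) (r : seq I) (P : pred I) (f : I -> V) :
  (forall i, P i -> W (f i)) -> W (\sum_(i <- r | P i) f i).
Proof. by move=> Wf; elim/big_rec: _ => [|i v Pi]; [apply: subspace0 | apply/subspaceD/Wf]. Qed.

Lemma subspace_unitZ c v :
  c \is a GRing.unit -> central c -> W (c *: v) -> W v.
Proof.
by move=> uc cc /(subspaceZ (centralV cc)); rewrite scalerA mulVr // scale1r.
Qed.

(* Interpolation. Dividing [f t - f t0] by [t - t0], where [f] is the polynomial with coefficients
   [v], lowers the degree at the cost of one excluded point [t0]. *)
Lemma subspace_coefs_but (bad : seq D) (k : nat) (v : nat -> V) :
  is_division_ring D -> infinite_center D ->
  (forall t, central t -> t \notin bad -> W (\sum_(i < k) t ^+ i *: v i)) ->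
  forall i, (i < k)%N -> W (v i).
Proof.
move=> hD infD; elim: k v bad => [//|k IHk] v bad Wf.
have [t0 [ct0 t0bad]] : exists t, central t /\ t \notin bad.
  apply: contrapT => no; apply: infD; exists bad => x cx.
  by apply: contrapT => /negP xbad; apply: no; exists x.
(* [w j] is the coefficient of [t ^+ j] in the quotient of [f t - f t0] by [t - t0]. *)
pose w j := \sum_(i < k.+1) (if (j < i)%N then t0 ^+ (i.-1 - j) else 0) *: v i.
have Ww j : (j < k)%N -> W (w j).
  apply: (IHk w (t0 :: bad)) => t ct; rewrite inE negb_or => /andP[tt0 tbad].
  apply: (@subspace_unitZ (t - t0)).
  - by apply: hD; rewrite subr_eq0.
  - exact/centralD/centralN.
  have -> : (t - t0) *: \sum_(j < k) t ^+ j *: w j =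
      \sum_(i < k.+1) t ^+ i *: v i - \sum_(i < k.+1) t0 ^+ i *: v i.
    rewrite -sumrB /w; under [in RHS]eq_bigr do rewrite -scalerBl.
    under [in LHS]eq_bigr do rewrite scaler_sumr.
    rewrite exchange_big scaler_sumr /=; apply: eq_bigr => i _.
    under eq_bigr do rewrite scalerA.
    rewrite -scaler_suml scalerA; congr (_ *: _).
    rewrite -[t ^+ i - _]opprB (@subrXX_comm _ t0 t) // -mulNr opprB; congr (_ * _).
    have ik : (i <= k)%N by rewrite -ltnS.
    rewrite (big_ord_widen _ (fun j => t0 ^+ (i.-1 - j) * t ^+ j) ik) [in RHS]big_mkcond.
    by apply: eq_bigr => l _; case: ifP => _; rewrite ?mulr0 // (centralX _ ct).
  by apply: subspaceB; apply: Wf.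
case: k => [|k] in v Wf IHk w Ww *.
  move=> i; rewrite ltnS leqn0 => /eqP ->.
  by have := Wf t0 ct0 t0bad; rewrite big_ord1 scale1r.
(* The top coefficient of the quotient is [v k.+1]. Subtracting its term lowers the degree of [f],
   so that induction gives the other coefficients. *)
have Wk : W (v k.+1).
  have := Ww k (ltnSn k); rewrite /w big_ord_recr /= ltnSn subnn scale1r.
  rewrite big1 ?add0r // => i _; case: ifP; rewrite ?scale0r //.
  by rewrite ltnNge -ltnS ltn_ord.
move=> i; rewrite ltnS leq_eqVlt => /predU1P[-> //|ik].
apply: (IHk v bad) => // t ct tbad.
have := Wf t ct tbad; rewrite big_ord_recr /= => Wt.
by rewrite -[X in W X](addrK (t ^+ k.+1 *: v k.+1)); apply/subspaceB/subspaceZ/Wk/centralX.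
Qed.

Lemma subspace_coefs (k : nat) (v : nat -> V) :
  is_division_ring D -> infinite_center D ->
  (forall t, central t -> W (\sum_(i < k) t ^+ i *: v i)) ->
  forall i, (i < k)%N -> W (v i).
Proof. by move=> hD infD Wf; apply: (@subspace_coefs_but [::]) => // t ct _; apply: Wf. Qed.

End Subspace.

(** * Derivatives of powers, and commutators with powers *)

Section PowerCommutators.
Context (D : unitRingType) (R : lalgType D).
Hypothesis scaleAr_central : forall (c : D) (a b : R), central c -> a * (c *: b) = c *: (a * b).

(** The derivative of the [d]-th power map at [b] in direction [h]: the sum of all
    [b ^+ i * h * b ^+ j] with [i + j + 1 = d]. *)
Fixpoint power_derivative (d : nat) (b h : R) : R :=
  if d is e.+1 then power_derivative e b h * b + b ^+ e * h else 0.

(** The sum has one term more than the degree requires, so that index 1 is in range even for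
    [d = 0]. *)
Lemma power_expansion d b h : exists v : nat -> R,
  [/\ v 0%N = b ^+ d, v 1%N = power_derivative d b h &
      forall t, central t -> (b + t *: h) ^+ d = \sum_(i < d.+2) t ^+ i *: v i].
Proof.
elim: d => [|d [v [v0 v1 vE]]].
  exists (fun i => (i == 0%N)%:R); split=> // t ct.
  by rewrite !big_ord_recl big_ord0 !expr0 scale1r scaler0 !addr0.
(* Coefficients after multiplication by [b + t *: h]; the values of [v] from [d.+2] on are
   arbitrary, hence the cut-off. *)
exists (fun i => (if (i < d.+2)%N then v i * b else 0) + (if i is j.+1 then v j * h else 0)).
split=> [||t ct]; first by rewrite /= addr0 v0 -exprSr.
  by rewrite /= v0 v1.
rewrite exprSr vE // mulrDr !mulr_suml; under [RHS]eq_bigr do rewrite scalerDr.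
rewrite [RHS]big_split /= [in X in _ = X + _]big_ord_recr [in X in _ = _ + X]big_ord_recl /=.
rewrite ltnn !scaler0 add0r addr0; congr (_ + _); apply: eq_bigr => i _.
  by rewrite ltn_ord scalerAl.
by rewrite scaleAr_central // -scalerAl scalerA exprS.
Qed.

(** The terms [b ^+ i * (a * b - b * a) * b ^+ j] telescope. *)
Lemma power_derivative_comm d a b :
  power_derivative d b (a * b) - power_derivative d b (b * a) = a * b ^+ d - b ^+ d * a.
Proof.
elim: d => [|d IHd] /=; first by rewrite mulr1 mul1r !subrr.
rewrite opprD addrACA -mulrBl IHd mulrBl -mulrBr exprSr.
by rewrite mulrBr !mulrA addrA addrNK.
Qed.

(* The coefficient of [t] in [((1 + t a) b) ^ d - (b (1 + t a)) ^ d]. *)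
Lemma power_commutator (W : R -> Prop) d a b :
  is_division_ring D -> infinite_center D -> subspace W ->
  (forall x y, W ((x * y) ^+ d - (y * x) ^+ d)) ->
  W (a * b ^+ d - b ^+ d * a).
Proof.
move=> hD infD subW Wd.
have [v [_ v1 vE]] := power_expansion d b (a * b).
have [w [_ w1 wE]] := power_expansion d b (b * a).
rewrite -power_derivative_comm -v1 -w1.
apply: (@subspace_coefs _ _ _ subW d.+2 (fun i => v i - w i)) => // t ct.
under eq_bigr do rewrite scalerBr.
rewrite sumrB -vE // -wE //.
have -> : b + t *: (a * b) = (1 + t *: a) * b by rewrite mulrDl mul1r scalerAl.
have -> : b + t *: (b * a) = b * (1 + t *: a) by rewrite mulrDr mulr1 scaleAr_central.
exact: Wd.
Qed.

End PowerCommutators.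

(** * Wedderburn's factorization *)

(** Hypotheses (i) and (ii) enter only through this property and the invertibility of [n]. It keeps
    the derivative of the minimal polynomial nonzero and allows division by the degree. *)
Definition tame_degrees (D : unitRingType) : Prop :=
  forall x : D, exists2 q, minimal_central_poly q x & ((size q).-1)%:R != 0 :> D.

(** The commutator with [x] is a derivation that kills the central coefficients and sends [w] to
    1. *)
Lemma commutator_horner (D : unitRingType) (x w : D) (p : {poly D}) :
  x * w - w * x = 1 -> poly_over_center p ->
  x * p.[w] - p.[w] * x = p^`().[w].
Proof.
move=> xw; elim/poly_ind: p => [|p c IHp] cp.
  by rewrite horner0 deriv0 horner0 mulr0 mul0r subrr.
have cpp : poly_over_center p.
  by move=> i; have := cp i.+1; rewrite coefD coefMX coefC addr0.
have cc : central c by have := cp 0%N; rewrite coefD coefMX coefC add0r.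
rewrite derivD derivC addr0 derivM derivX mulr1 hornerMXaddC.
rewrite hornerD hornerMX mulrDr mulrDl cc opprD addrACA subrr addr0.
rewrite -(IHp cpp) mulrBl -[X in _ = _ + X]mulr1 -xw mulrBr !mulrA.
by rewrite addrA addrNK.
Qed.

Lemma commutator_neq1 (D : unitRingType) (x w : D) :
  tame_degrees D -> x * w - w * x != 1.
Proof.
move=> tD; apply/eqP => xw; have [q [mon_q cq /rootP qw min_q] m0] := tD w.
have q0 : q != 0 by rewrite monic_neq0.
have /eqP := commutator_horner xw cq; rewrite qw mulr0 mul0r subrr eq_sym => /eqP q'w.
have q'0 : q^`() = 0.
  apply: min_q; [| exact/rootP | exact: lt_size_deriv].
  by move=> i; rewrite coef_deriv -mulr_natr; apply: centralM => //; apply: central_nat.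
(* As [q] is monic, the top coefficient of its derivative is the degree of [q]. *)
case m: (size q).-1 m0 => [|k]; first by rewrite eqxx.
have /eqP : q^`()`_k = 0 by rewrite q'0 coef0.
rewrite coef_deriv -m -/(lead_coef q) (monicP mon_q) m.
by move=> ->.
Qed.

Lemma horner_mul_conj (D : unitRingType) (p q : {poly D}) (y : D) :
  q.[y] \is a GRing.unit -> (p * q).[y] = p.[q.[y] * y / q.[y]] * q.[y].
Proof.
move=> u; elim/poly_ind: p => [|p c IHp]; first by rewrite mul0r !horner0 mul0r.
rewrite mulrDl -mulrA -(commr_polyX q) mulrA hornerD hornerMX hornerCM IHp.
rewrite hornerMXaddC mulrDl -!mulrA; congr (_ * _ + _).
by rewrite mulVr // mulr1.
Qed.

Lemma horner_conj (D : unitRingType) (p : {poly D}) (u y : D) :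
  u \is a GRing.unit -> p.[u * y / u] = (p * u%:P).[y] / u.
Proof. by move=> uu; rewrite horner_mul_conj hornerC // mulrK. Qed.

Lemma central_poly_commC (D : unitRingType) (p : {poly D}) (u : D) :
  poly_over_center p -> p * u%:P = u%:P * p.
Proof. by move=> cp; apply/polyP => i; rewrite coefMC coefCM cp. Qed.

(* A nonzero polynomial of least degree vanishing on a conjugacy class is, up to a scalar, fixed by
   conjugation, hence has central coefficients. *)
Lemma size_vanishing_on_conjugates (D : unitRingType) (q : {poly D}) (x : D) (g : {poly D}) :
  is_division_ring D -> minimal_central_poly q x -> g != 0 ->
  (forall u, u \is a GRing.unit -> g.[u * x / u] = 0) -> (size q <= size g)%N.
Proof.
move=> hD [_ _ _ min_q].
have [k] := ubnP (size g); elim: k g => // k IHk g size_g g0 van_g.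
pose a := lead_coef g; have ua : a \is a GRing.unit by rewrite hD // lead_coef_eq0.
pose h : {poly D} := a^-1%:P * g.
have lh : h`_(size g).-1 = 1 by rewrite coefCM mulVr.
have size_h : (size h <= size g)%N.
  by apply/leq_sizeP => i gi; rewrite coefCM nth_default ?mulr0.
have van_h u : u \is a GRing.unit -> h.[u * x / u] = 0.
  by move=> uu; rewrite hornerCM van_g ?mulr0.
have h0 : h != 0 by apply: contraTneq isT => h0; move/eqP: lh; rewrite h0 coef0 eq_sym oner_eq0.
have [ch|/existsNP[i /existsNP[u cu]]] := pselect (poly_over_center h).
  rewrite leqNgt; apply/negP => gq; move/eqP: h0; apply; apply: min_q => //.
    by apply/rootP; have := van_h 1 (unitr1 _); rewrite mul1r divr1.
  exact: leq_ltn_trans gq.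
have u0 : u != 0 by apply: contra_not_neq cu => ->; rewrite mulr0 mul0r.
have uu := hD u u0.
pose f : {poly D} := h - u%:P * h * u^-1%:P.
have f_coef j : f`_j = h`_j - u * h`_j / u by rewrite coefB coefMC coefCM.
have size_f : (size f < size g)%N.
  rewrite -(ltn_predK (_ : 0 < size g)%N) ?size_poly_gt0 // ltnS; apply/leq_sizeP => j gj.
  rewrite f_coef; move: gj; rewrite leq_eqVlt => /predU1P[<-|gj].
    by rewrite lh mulr1 divrr // subrr.
  rewrite (_ : h`_j = 0) ?mulr0 ?mul0r ?subrr // nth_default // (leq_trans size_h) //.
  by rewrite -ltnS in gj; apply: leq_trans (leqSpred _) _.
apply: leq_trans (ltnW size_f); apply: IHk.
- exact: leq_trans size_f _.
- apply/eqP => f0; apply: cu; have := f_coef i; rewrite f0 coef0 => /eqP.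
  rewrite eq_sym subr_eq0 => /eqP e.
  by rewrite {1}e divrK.
move=> v uv; rewrite hornerD hornerN (van_h _ uv) sub0r -mulrA hornerCM.
have uV : u^-1 \is a GRing.unit by rewrite unitrV.
rewrite horner_mul_conj hornerC //.
have -> : u^-1 * (v * x / v) / u^-1 = (u^-1 * v) * x / (u^-1 * v) by rewrite invrM // !mulrA.
by rewrite van_h ?(unitrMl _ uv) // mul0r mulr0 oppr0.
Qed.

(* Wedderburn: the minimal polynomial splits as a product of factors ['X - y%:P] with [y] conjugate
   to [x], and conjugates agree modulo commutators. Multiplying [g] by ['X] makes its subleading
   coefficient available also when [r = 0]. *)
Lemma wedderburn_factor (D : unitRingType) (q : {poly D}) (x : D) (U : D -> Prop) r :
  is_division_ring D -> minimal_central_poly q x ->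
  U 0 -> (forall a b, U a -> U b -> U (a + b)) -> (forall a b, U (a * b - b * a)) ->
  (r < size q)%N ->
  exists f g : {poly D}, [/\ q = f * g, g \is monic, size g = r.+1 & U ((g * 'X)`_r + x *+ r)].
Proof.
move=> hD min_q U0 UD Uc; have [mon_q cq /rootP qx _] := min_q.
elim: r => [|r IHr] rq.
  by exists q, 1; rewrite mulr1 monic1 size_poly1 mul1r coefX addr0.
have [f [g [qE mon_g size_g Ug]]] := IHr (ltnW rq).
have [u [uu gu]] : exists u, u \is a GRing.unit /\ g.[u * x / u] != 0.
  apply: contrapT => no.
  have : (size q <= size g)%N.
    apply: (size_vanishing_on_conjugates hD min_q (monic_neq0 mon_g)) => u uu.
    by apply/eqP; apply: contrapT => /negP gu; apply: no; exists u.
  by rewrite size_g leqNgt rq.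
set y := u * x / u in gu; set v := g.[y] in gu; have uv := hD v gu.
have qy : q.[y] = 0 by rewrite horner_conj // central_poly_commC // hornerCM qx mulr0 mul0r.
(* [y] is a root of [q] but not of [g], so the product formula makes a conjugate of [y] a root of
   [f]. *)
have : root f (v * y / v).
  apply/rootP; move: qy; rewrite qE horner_mul_conj -/v // => /(congr1 ( *%R^~ v^-1)).
  by rewrite mulrK // mul0r.
set z := v * y / v => /factor_theorem[f' fE].
exists f', (('X - z%:P) * g); split.
- by rewrite mulrA -fE.
- by rewrite monicMl ?monicXsubC.
- by rewrite size_Mmonic ?polyXsubC_eq0 // size_XsubC size_g.
(* The new factor subtracts [z] from the subleading coefficient, and [x - z] is the commutator of
   [x * (v * u)^-1] with [v * u]. *)
have -> : ((('X - z%:P) * g) * 'X)`_r.+1 + x *+ r.+1 =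
    ((g * 'X)`_r + x *+ r) + (x * (v * u)^-1 * (v * u) - (v * u) * (x * (v * u)^-1)).
  rewrite coefMX /= mulrBl coefB -(commr_polyX g) coefCM.
  have -> : g`_r = 1 by rewrite -(monicP mon_g) lead_coefE size_g.
  have uvu : v * u \is a GRing.unit by rewrite (unitrMl _ uu).
  rewrite mulr1 mulrVK // mulrSr addrACA -!addrA; congr (_ + (_ + _)).
  rewrite addrC; congr (_ - _).
  by rewrite /z /y invrM // !mulrA.
exact: UD.
Qed.

(** When [r] is the degree of [q], the factor [g] is [q] itself, with central subleading
    coefficient. So [U] contains the degree times [x], and the degree is invertible. *)
Lemma subspace_full (D : unitRingType) (U : D^o -> Prop) :
  is_division_ring D -> tame_degrees D -> subspace U ->
  (forall c : D, central c -> U c) -> (forall a b : D, U (a * b - b * a)) ->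
  forall x, U x.
Proof.
move=> hD tD subU UF Uc x; have [q min_q m0] := tD x.
have [mon_q cq _ _] := min_q; have q0 := monic_neq0 mon_q.
have mq : ((size q).-1 < size q)%N by rewrite ltn_predL size_poly_gt0.
have [f [g [qE mon_g size_g Ug]]] :=
  wedderburn_factor hD min_q (subspace0 subU) (subspaceD subU) Uc mq.
have size_f : size f = 1%N.
  have f0 : f != 0 by apply: contraNneq q0 => f0; rewrite qE f0 mul0r.
  have /eqP := congr1 (size : {poly D} -> nat) qE.
  rewrite size_Mmonic // size_g prednK ?size_poly_gt0 //.
  rewrite -[X in X == _]add0n addnC.
  have : (0 < size f)%N by rewrite size_poly_gt0.
  case: (size f) => // k _; rewrite addSn /= [X in _ == X]addnC addn0.
  by rewrite -[X in X == _]addn0 eqn_add2l => /eqP <-.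
have gq : g = q.
  have /eqP/size_poly1P[c _ fc] := size_f.
  have := congr1 lead_coef qE.
  rewrite lead_coef_Mmonic // (monicP mon_q) fc lead_coefC => c1.
  by rewrite qE fc -c1 mul1r.
have Uq : U ((g * 'X)`_(size q).-1).
  by apply: UF; rewrite gq coefMX; case: ifP => _; [apply: central0 | apply: cq].
apply: (@subspace_unitZ _ _ _ subU (size q).-1%:R).
- exact: hD.
- exact: central_nat.
have := subspaceB subU Ug Uq; rewrite addrC addKr.
by rewrite /GRing.scale /= mulr_natl.
Qed.

(** * The span of the powers in a division ring *)

Definition adjoint (R : pzRingType) (x y : R) : R := x * y - y * x.

(** The binomial formula for the difference of left and right multiplication by [x], which
    commute. *)
Lemma iter_adjoint (R : pzRingType) (x y : R) k :
  iter k (adjoint x) y =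
  \sum_(i < k.+1) (-1) ^+ i * (x ^+ (k - i) * y * x ^+ i) *+ 'C(k, i).
Proof.
elim: k => [|k IHk]; first by rewrite big_ord1 /= !mul1r mulr1.
rewrite iterS IHk /adjoint mulr_sumr mulr_suml -sumrN.
rewrite big_ord_recl [in X in _ + X]big_ord_recr /=.
rewrite [RHS]big_ord_recl [X in _ = _ + X]big_ord_recr /=.
rewrite !bin0 !binn !subn0 !subnn !mul1r !mulr1n !mulr1 exprS !mulrA.
rewrite -!addrA; congr (_ + _); rewrite !addrA; congr (_ + _); last first.
  by rewrite /bump add1n -!mulrA -(exprSr x) -(exprS x) [(-1) ^+ k.+1]exprS mulN1r mulNr.
rewrite -big_split; apply: eq_bigr => i _ /=; rewrite /bump /= add1n subSS.
rewrite binS mulrnDr; congr (_ + _).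
  rewrite mulrnAr; congr (_ *+ _).
  rewrite -(subnSK (ltn_ord i)) (exprS x (k - i.+1)) mulrA (commr_sign x).
  by rewrite !mulrA.
by rewrite mulrnAl -mulNrn -!mulrA -exprSr [(-1) ^+ i.+1]exprS mulN1r mulNr.
Qed.

(** If [v = adjoint x r] is nonzero and commutes with [x], then [adjoint x (r / v) = 1], which
    [commutator_neq1] excludes. So the kernels of the iterates do not grow. *)
Lemma central_of_adjoint_nilpotent (D : unitRingType) (x : D) k :
  is_division_ring D -> tame_degrees D ->
  (forall y, iter k.+1 (adjoint x) y = 0) -> central x.
Proof.
move=> hD tD nil y; apply/eqP; rewrite -subr_eq0; apply/eqP; rewrite -/(adjoint x y).
have {nil} : iter k.+1 (adjoint x) y = 0 by [].
elim: k => // k IHk; rewrite iterS => nil; apply: IHk.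
move: nil; rewrite iterS; set r := iter k _ y; move=> nil.
apply/eqP/negPn/negP => v0; have uv := hD _ v0.
have xV : x * (adjoint x r)^-1 = (adjoint x r)^-1 * x.
  by apply/commrV/eqP; rewrite -subr_eq0; apply/eqP.
have /eqP := commutator_neq1 x (r / adjoint x r) tD; apply.
by rewrite -mulrA -xV !mulrA -mulrBl -/(adjoint x r) divrr.
Qed.

Lemma subspace_central (D : unitRingType) : @subspace D D^o central.
Proof. by split; [apply: central0 | move=> u v; apply: centralD | move=> c v; apply: centralM]. Qed.

Lemma regular_scaleAr (D : unitRingType) (c : D) (a b : D^o) :
  central c -> a * (c *: b) = c *: (a * b).
Proof. by move=> cc; rewrite /GRing.scale /= mulrA -(cc a) mulrA. Qed.

(* Take [d] minimal: expanding [(1 + t x) ^ d] shows that the inner binomial coefficients vanish in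
   [D], so the [d]-th power of [adjoint x] is [adjoint (x ^+ d)], which is zero. *)
Lemma central_of_central_powers (D : unitRingType) d :
  is_division_ring D -> infinite_center D -> tame_degrees D ->
  (0 < d)%N -> (forall x : D, central (x ^+ d)) -> forall x : D, central x.
Proof.
move=> hD infD tD; have [k] := ubnP d; elim: k d => // k IHk d dk d0 cd.
have [[j [j0 jd bj]]|no] := pselect (exists j, [/\ (0 < j)%N, (j < d)%N & 'C(d, j)%:R != 0 :> D]).
  apply: (IHk j) => // [|x]; first exact: leq_trans jd _.
  have ubj := hD _ bj.
  apply: (@subspace_unitZ _ _ _ (@subspace_central D) 'C(d, j)%:R) => //; first exact: central_nat.
  apply: (@subspace_coefs _ _ _ (@subspace_central D) d.+1
    (fun i => 'C(d, i)%:R * x ^+ i : D^o)) => //.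
    move=> t ct; have := cd (1 + t * x).
    rewrite exprDn_comm; last exact/commr_sym/commr1.
    set s := \sum_(i < _) _; set s' := \sum_(i < _) _; suff -> : s = s' by [].
    apply: eq_bigr => i _; rewrite expr1n mul1r exprMn_comm; last exact: ct.
    by rewrite /GRing.scale /= mulr_natl mulrnAr.
  exact: ltnW.
move=> x; case: d => [//|d] in dk d0 cd no *.
apply: (@central_of_adjoint_nilpotent _ _ d) => // y.
have b0 i : (0 < i)%N -> (i < d.+1)%N -> forall z : D, z *+ 'C(d.+1, i) = 0.
  move=> i0 id z; rewrite -mulr_natl; apply: contrapT => /eqP h; apply: no; exists i; split=> //.
  by apply: contraNneq h => ->; rewrite mul0r.
(* Expand [(1 - 1) ^+ d.+1], whose inner terms vanish. This gives the two outer terms of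
   [iter_adjoint] opposite signs. *)
have sign : 1 + (-1) ^+ d.+1 = 0 :> D.
  rewrite -[RHS](expr0n D d.+1) -(subrr (1 : D)) exprDn_comm; last exact: commrN1.
  rewrite big_ord_recl big_ord_recr /= big1 => [|i _].
    by rewrite /bump add1n bin0 binn subn0 subnn !expr1n !mul1r !mulr1n add0r.
  by rewrite b0 // /bump /= add1n ltnS.
rewrite iter_adjoint big_ord_recl big_ord_recr /= big1 => [|i _].
  rewrite /bump add1n bin0 binn subn0 subnn !mul1r !mulr1n add0r mulr1 cd.
  by rewrite -[X in X + _]mul1r -mulrDl sign mul0r.
by rewrite b0 // /bump /= add1n ltnS.
Qed.

(** The span as the intersection of all subspaces containing the powers: membership is then itself
    an induction principle. *)
Definition power_span (D : unitRingType) (d : nat) (x : D) : Prop :=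
  forall V : D^o -> Prop, subspace V -> (forall b : D, V (b ^+ d)) -> V x.

Lemma subspace_power_span (D : unitRingType) d : @subspace D D^o (@power_span D d).
Proof.
split=> [V /subspace0 //|u v Pu Pv V subV Vb|c v cc Pv V subV Vb].
  by apply: (subspaceD subV); [apply: Pu | apply: Pv].
by apply: (subspaceZ subV) => //; apply: Pv.
Qed.

(** Reduces claims about commutators with [a] to a spanning set of [b]. *)
Lemma subspace_commutator (D : unitRingType) (R : lalgType D) (W : R -> Prop) (a : R) :
  (forall (c : D) (a b : R), central c -> a * (c *: b) = c *: (a * b)) ->
  subspace W -> subspace (fun b => W (a * b - b * a)).
Proof.
move=> scaleAr subW; split=> [|u v Wu Wv|c v cc Wv].
- by rewrite mulr0 mul0r subrr; apply: subspace0 subW.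
- by rewrite mulrDr mulrDl opprD addrACA; apply: subspaceD.
- by rewrite scaleAr // -scalerAl -scalerBr; apply: subspaceZ.
Qed.

(** By linearity [x] may be taken to be a power [b ^+ d], and then [power_commutator] applies. *)
Lemma power_span_lie (D : unitRingType) d (r x : D) :
  is_division_ring D -> infinite_center D ->
  power_span d x -> power_span d (r * x - x * r).
Proof.
move=> hD infD Px; have subP := subspace_power_span D d.
apply: (Px (fun y => power_span d (r * y - y * r))).
  exact: (@subspace_commutator D D^o _ r (@regular_scaleAr D) subP).
move=> b; apply: (@power_commutator D D^o (@regular_scaleAr D) _ d r b) => // y z.
by apply: (subspaceB subP) => V subV; apply.
Qed.

(* Herstein: the powers span a Lie ideal [P], and [T] is a subring. If [a], [b] in [T] do not
   commute, then [T] contains the right ideal [(a * b - b * a) D]. If [T] is commutative,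
   then [adjoint x] has square zero for every [x] in [T]. *)
Lemma power_span_commutators (D : unitRingType) d :
  is_division_ring D -> infinite_center D -> tame_degrees D -> (0 < d)%N ->
  (forall a b : D, power_span d (a * b - b * a)) \/ (forall x : D, central x).
Proof.
move=> hD infD tD d0; pose P := @power_span D d; have subP := subspace_power_span D d.
pose T x := forall r, P (r * x - x * r).
have PT x : P x -> T x by move=> Px r; apply: power_span_lie.
have TN x : T x -> forall r, P (x * r - r * x).
  by move=> Tx r; have := subspaceN subP (Tx r); rewrite opprB.
have TM x y : T x -> T y -> T (x * y).
  move=> Tx Ty r; have := subspaceD subP (Ty (r * x)) (Tx (y * r)).
  by rewrite !mulrA addrA addrNK.
have TB x y : T x -> T y -> T (x - y).
  move=> Tx Ty r; have := subspaceB subP (Tx r) (Ty r).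
  suff -> : r * x - x * r - (r * y - y * r) = r * (x - y) - (x - y) * r by [].
  by rewrite mulrBr mulrBl !opprB addrACA [RHS]addrACA; congr (_ + _); apply: addrC.
have [[a [b [Ta Tb ab]]]|comm] := pselect (exists a b, [/\ T a, T b & a * b != b * a]).
  left=> r x; move: r; change (T x).
  have uc : a * b - b * a \is a GRing.unit by rewrite hD // subr_eq0.
  rewrite -[x](mulVKr uc); set y := _^-1 * x.
  (* [(a * b - b * a) * y] equals [[a, b * y] - b * [a, y]], and both commutators lie in [P], hence
     in [T]. *)
  have := TB _ _ (PT _ (TN _ Ta (b * y))) (TM _ _ Tb (PT _ (TN _ Ta y))).
  by rewrite mulrBr mulrBl !mulrA opprB addrA addrNK.
right; apply: (central_of_central_powers hD infD tD d0) => x.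
have Tx : T (x ^+ d) by apply: PT => V _; apply.
apply: (@central_of_adjoint_nilpotent _ _ 1) => // y /=.
apply/eqP; rewrite subr_eq0; apply/negPn/negP => e; apply: comm.
by exists (x ^+ d), (adjoint (x ^+ d) y); split=> //; exact: PT _ (TN _ Tx y).
Qed.

(** [subspace_full] is used twice: on the set of [b] with [[a, b]] in [U], which contains the power
    span and so all commutators, and then on [U]. *)
Lemma subspace_power_full (D : unitRingType) (U : D^o -> Prop) d :
  is_division_ring D -> infinite_center D -> tame_degrees D -> (0 < d)%N ->
  subspace U -> (forall c : D, central c -> U c) ->
  (forall a b : D, U (a * b ^+ d - b ^+ d * a)) -> forall x, U x.
Proof.
move=> hD infD tD d0 subU UF Ud.
have [Pc|ac x] := power_span_commutators hD infD tD d0; last exact/UF/ac.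
apply: subspace_full => // a b; move: b.
have subUa := @subspace_commutator D D^o U a (@regular_scaleAr D) subU.
apply: (@subspace_full D (fun b => U (a * b - b * a))) => //.
  by move=> c cc; rewrite cc subrr; apply: subspace0 subU.
by move=> x y; exact: Pc subUa (Ud a).
Qed.

(** * Matrices *)

Lemma mx_scaleAr_central (D : unitRingType) n (c : D) (A B : 'M[D]_n.+1) :
  central c -> A * (c *: B) = c *: (A * B).
Proof.
move=> cc; apply/matrixP => i j; rewrite !mxE mulr_sumr.
by apply: eq_bigr => k _; rewrite mxE !mulrA cc.
Qed.

Lemma mx_central_scalar (D : unitRingType) n (c : D) :
  central c -> @mx_central D n.+1 c%:M.
Proof.
by move=> cc B; rewrite -[c]mulr1 -scale_scalar_mx mx_scaleAr_central // -scalerAl mulr1 mul1r.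
Qed.

Lemma mul_scale_delta (D : unitRingType) n (i j k l : 'I_n.+1) (x y : D) :
  (x *: delta_mx i j) * (y *: delta_mx k l) = ((x * y) *: delta_mx i l) *+ (j == k) :> 'M[D]_n.+1.
Proof.
rewrite -scalerAl.
have -> : delta_mx i j * (y *: delta_mx k l) = y *: (delta_mx i j * delta_mx k l) :> 'M[D]_n.+1.
  apply/matrixP => a b; rewrite !mxE mulr_sumr; apply: eq_bigr => c _; rewrite !mxE.
  by rewrite !mulr_natl -!mulrnAr.
by rewrite -mulmxE mul_delta_mx_cond scalerA scalerMnr.
Qed.

Lemma expr_idempotent (R : pzRingType) (e : R) d : e * e = e -> (0 < d)%N -> e ^+ d = e.
Proof. by move=> ee; case: d => // d _; elim: d => // d IHd; rewrite exprS IHd. Qed.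

Section MatrixPowers.
Context (D : unitRingType) (n : nat) (W : 'M[D]_n.+1 -> Prop) (d : nat).
Hypotheses (hD : is_division_ring D) (tD : tame_degrees D).
Hypotheses (d_gt0 : (0 < d)%N) (n_neq0 : n.+1%:R != 0 :> D) (subW : subspace W).
Hypothesis W_central : forall Z : 'M[D]_n.+1, mx_central Z -> W Z.
Hypothesis W_powers : forall A B : 'M[D]_n.+1, W (A * B ^+ d - B ^+ d * A).

Lemma matrix_powers_full1 : infinite_center D -> n = 0%N -> forall M, W M.
Proof.
move=> infD n0 M.
have {M} [x ->] : exists x, M = x%:M.
  have ord_eq0 (i : 'I_n.+1) : i = 0.
    by apply: val_inj; case: i => i /=; rewrite n0 ltnS leqn0 => /eqP.
  by exists (M 0 0); apply/matrixP => i j; rewrite mxE (ord_eq0 i) (ord_eq0 j).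
apply: (@subspace_power_full D (fun x => W x%:M) d) => // [|c cc|a b].
- split=> [|u v Wu Wv|c v cc Wv].
  + by rewrite raddf0; apply: subspace0.
  + by rewrite raddfD; apply: subspaceD.
  + by rewrite -scale_scalar_mx; apply: subspaceZ.
- exact/W_central/mx_central_scalar.
by rewrite rmorphB !rmorphM rmorphXn; apply: W_powers.
Qed.

Lemma commutator_idempotent A E : E * E = E -> W (A * E - E * A).
Proof. by move=> EE; have := W_powers A E; rewrite expr_idempotent. Qed.

(** The matrix [f = x *: delta_mx i j] is the difference of the idempotents [e + f] and [e]. *)
Lemma commutator_delta A i j x : i != j ->
  W (A * (x *: delta_mx i j) - (x *: delta_mx i j) * A).
Proof.
move=> ij; have ji : (j == i) = false by rewrite eq_sym (negPf ij).
have sub_A := subspace_commutator A (@mx_scaleAr_central D n) subW.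
set f := x *: _; pose e : 'M[D]_n.+1 := 1 *: delta_mx i i.
have ee : e * e = e by rewrite mul_scale_delta eqxx mulr1.
have ef : e * f = f by rewrite mul_scale_delta eqxx mul1r.
have fe : f * e = 0 by rewrite mul_scale_delta ji.
have ff : f * f = 0 by rewrite mul_scale_delta ji.
have eff : (e + f) * (e + f) = e + f by rewrite mulrDl !mulrDr ee ef fe ff !addr0.
have := subspaceB sub_A (commutator_idempotent A eff) (commutator_idempotent A ee).
by rewrite /= [e + f]addrC addrK.
Qed.

Lemma delta_offdiag i j x : i != j -> W (x *: delta_mx i j).
Proof.
move=> ij; have := commutator_delta (1 *: delta_mx i i) x ij.
by rewrite !mul_scale_delta eqxx eq_sym (negPf ij) subr0 mul1r.
Qed.

Lemma delta_diagB i j x y : i != j ->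
  W ((x * y) *: delta_mx i i - (y * x) *: delta_mx j j).
Proof.
rewrite eq_sym => ij; have := commutator_delta (x *: delta_mx i j) y ij.
by rewrite !mul_scale_delta !eqxx.
Qed.

Lemma matrix_powers_full2 : n != 0%N -> forall M, W M.
Proof.
move=> n0.
have W00 i x : W (x *: delta_mx 0 0 - x *: delta_mx i i).
  have [->|i0] := eqVneq 0 i; first by rewrite subrr; apply: subspace0.
  by have := delta_diagB x 1 i0; rewrite mulr1 mul1r.
have W0 : forall x, W (x *: delta_mx 0 0).
  apply: (@subspace_full D (fun x => W (x *: delta_mx 0 0))) => //.
  - split=> [|u v Wu Wv|c v cc Wv].
    + by rewrite scale0r; apply: subspace0.
    + by rewrite scalerDl; apply: subspaceD.
    + by rewrite -scalerA; apply: subspaceZ.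
  - move=> c cc; apply: (subspace_unitZ subW (hD n_neq0) (@central_nat _ _)).
    (* This sum is [n.+1] times [c *: delta_mx 0 0]. *)
    have : W (\sum_(i < n.+1) (c *: delta_mx 0 0 - c *: delta_mx i i) + c%:M).
      apply: subspaceD => //; last exact/W_central/mx_central_scalar.
      by apply: subspace_sum => // i _; apply: W00.
    rewrite sumrB sumr_const card_ord -scaler_sumr -scalemx1 mx1_sum_delta addrNK.
    by rewrite scaler_nat.
  have n1 : 0 != ord_max :> 'I_n.+1 by rewrite -val_eqE /= eq_sym.
  (* The second diagonal position absorbs [b * a], which is then moved back to the corner; this
     needs two distinct indices. *)
  move=> a b; have := subspaceB subW (delta_diagB a b n1) (W00 ord_max (b * a)).
  by rewrite opprB addrA addrNK -scalerBl.
move=> M; rewrite (matrix_sum_delta M).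
apply: subspace_sum => // i _; apply: subspace_sum => // j _.
have [<-|] := eqVneq i j; last exact: delta_offdiag.
by have := subspaceB subW (W0 (M i i)) (W00 i (M i i)); rewrite opprB addrC addrNK.
Qed.

Lemma matrix_powers_full : infinite_center D -> forall M, W M.
Proof.
have [|] := eqVneq n 0%N; first by move=> n0 infD; apply: matrix_powers_full1.
by move=> n0 _; apply: matrix_powers_full2.
Qed.

End MatrixPowers.

(** * From the polynomial to its leading power, and the two hypotheses *)

Lemma scale_exprn_central (D : unitRingType) n (t : D) (A : 'M[D]_n.+1) k :
  central t -> (t *: A) ^+ k = t ^+ k *: A ^+ k.
Proof.
move=> ct; elim: k => [|k IHk]; first by rewrite !expr0 scale1r.
by rewrite !exprS IHk -scalerAl mx_scaleAr_central ?scalerA //; apply: centralX.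
Qed.

Lemma minimal_central_poly_exists (D : unitRingType) (x : D) (q : {poly D}) :
  is_division_ring D -> q != 0 -> poly_over_center q -> root q x ->
  exists r, minimal_central_poly r x.
Proof.
move=> hD; have [k] := ubnP (size q); elim: k q => // k IHk q qk q0 cq qx.
have [[r [r0 cr rx rq]]|no] :=
    pselect (exists r, [/\ r != 0, poly_over_center r, root r x & (size r < size q)%N]).
  by apply: (IHk r) => //; apply: leq_trans rq _.
have ul : lead_coef q \is a GRing.unit by rewrite hD ?lead_coef_eq0.
have cV : central (lead_coef q)^-1 by apply/centralV/cq.
exists ((lead_coef q)^-1%:P * q).
have size_q : size ((lead_coef q)^-1%:P * q) = size q.
  by rewrite mul_polyC lreg_size //; apply: mulrI; rewrite unitrV.
split.
- by rewrite monicE lead_coefE size_q coefCM -lead_coefE mulVr.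
- by move=> i; rewrite coefCM; apply: centralM.
- by apply/rootP; rewrite hornerCM (rootP qx) mulr0.
move=> r cr rx; rewrite size_q => rq; apply: contrapT => /eqP r0.
by apply: no; exists r.
Qed.

(** A vanishing positive integer would have a vanishing prime factor; this is read in the center,
    which is a field. *)
Lemma natr_neq0_pchar0 (D : unitRingType) k :
  is_division_ring D -> [pchar D] =i pred0 -> (0 < k)%N -> k%:R != 0 :> D.
Proof.
move=> hD char0 k0; apply/eqP => kD.
have /eqP kF : k%:R = 0 :> center_of hD by apply: val_inj; rewrite rmorph_nat rmorph0.
have [l /andP[pr_l /eqP lF]] := natf0_pchar k0 kF.
have /= := char0 l; rewrite inE pr_l /= => /eqP; apply.
by have /(congr1 val) := lF; rewrite rmorph_nat rmorph0.
Qed.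

Lemma tame_degrees_of_hypothesis (D : unitRingType) (n : nat) :
  is_division_ring D -> (0 < n)%N ->
  ( (algebraic_division_ring D /\ [pchar D] =i pred0)
    \/
    (exists (l : nat) (s : seq D) (k : nat),
        [/\ (0 < l)%N /\ l \in [pchar D], center_basis s,
            size s = (k * k)%N, ~~ (l %| k)%N & ~~ (l %| n)%N]) ) ->
  tame_degrees D /\ n%:R != 0 :> D.
Proof.
move=> hD n0 [[algD char0]|[l [s [k [[_ lD] s_basis size_s lk ln]]]]].
  split=> [x|]; last exact: natr_neq0_pchar0.
  have [q [q0 cq qx]] := algD x.
  have [|r min_r] := @minimal_central_poly_exists D x q hD q0 cq.
    by apply/rootP; rewrite horner_coef.
  exists r => //; apply: natr_neq0_pchar0 => //.
  have [mon_r _ /rootP rx _] := min_r.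
  rewrite -subn1 subn_gt0 ltnNge; apply/negP => /size1_polyC rC.
  move: rx (monic_neq0 mon_r); rewrite rC hornerC => ->; by rewrite polyC0 eqxx.
split=> [x|]; last by rewrite -(dvdn_pcharf lD).
have [q min_q q_dvd] := minimal_central_poly_dvd x hD s_basis.
exists q => //; rewrite -(dvdn_pcharf lD); apply: contra lk => lq.
(* The degree divides [k * k], so the prime [l] would divide [k]. *)
have := dvdn_trans lq q_dvd; rewrite size_s Euclid_dvdM ?orbb //.
by case/andP: lD.
Qed.

Lemma peval_mx_scale (D : unitRingType) n (p : {poly D}) (t : D) (A : 'M[D]_n.+1) :
  poly_over_center p -> central t ->
  peval_mx p (t *: A) = \sum_(i < size p) t ^+ i *: (p`_i *: A ^+ i).
Proof.
move=> cp ct; apply: eq_bigr => i _.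
by rewrite scale_exprn_central // !scalerA cp.
Qed.

Lemma subspace_polynomial_commutators_full
    (D : unitRingType) (n : nat) (p : {poly D}) (W : 'M[D]_n.+1 -> Prop) :
  is_division_ring D -> infinite_center D -> tame_degrees D -> n.+1%:R != 0 :> D ->
  poly_over_center p -> (1 < size p)%N -> subspace W ->
  (forall Z : 'M[D]_n.+1, mx_central Z -> W Z) ->
  (forall A B : 'M[D]_n.+1, W (peval_mx p (A * B) - peval_mx p (B * A))) ->
  forall M, W M.
Proof.
move=> hD infD tD n0 cp size_p subW WZ Wp.
have p0 : p != 0 by rewrite -size_poly_gt0 ltnW.
pose d := (size p).-1; have dp : (d < size p)%N by rewrite ltn_predL ltnW.
have Wd (A B : 'M[D]_n.+1) : W ((A * B) ^+ d - (B * A) ^+ d).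
  apply: (subspace_unitZ subW (hD (lead_coef p) _) (cp d)); first by rewrite lead_coef_eq0.
  (* The values at [t] are the given differences for [t *: A] and [B]. *)
  apply: (@subspace_coefs _ _ _ subW (size p)
    (fun i => p`_i *: ((A * B) ^+ i - (B * A) ^+ i))) => // t ct.
  under eq_bigr do rewrite !scalerBr.
  rewrite sumrB -!peval_mx_scale //.
  by rewrite [t *: (A * B)]scalerAl -(mx_scaleAr_central B A ct); apply: Wp.
apply: (@matrix_powers_full D n W d) => // [|A B]; first by rewrite -ltnS prednK // ltnW.
by apply: power_commutator => // c U V; apply: mx_scaleAr_central.
Qed.

Theorem theorem4p11 (D : unitRingType) (n : nat) (p : {poly D}) :
  is_division_ring D ->
  infinite_center D ->
  (0 < n)%N ->
  poly_over_center p ->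
  (1 < size p)%N ->
  ( (algebraic_division_ring D /\ [pchar D] =i pred0)
    \/
    (exists (l : nat) (s : seq D) (k : nat),
        [/\ (0 < l)%N /\ l \in [pchar D], center_basis s,
            size s = (k * k)%N, ~~ (l %| k)%N & ~~ (l %| n)%N]) ) ->
  forall M : 'M[D]_n,
    exists (Z : 'M[D]_n) (m : nat) (c : 'I_m -> D) (A B : 'I_m -> 'M[D]_n),
      [/\ mx_central Z,
          (forall i, central (c i)) &
          M = Z + \sum_(i < m) c i *: (peval_mx p (A i * B i) - peval_mx p (B i * A i))].
Proof.
move=> hD infD n_gt0 cp size_p hyp.
have [tD n0] := tame_degrees_of_hypothesis hD n_gt0 hyp.
case: n n_gt0 n0 {hyp} => // n _ n0.
(* Here [W] is the set of matrices of the required form. *)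
apply: (subspace_polynomial_commutators_full hD infD tD n0 cp size_p).
- split.
  + by exists 0, 0%N, (fun=> 0), (fun=> 0), (fun=> 0); split=> [B|[]|//];
      rewrite ?mul0r ?mulr0 ?big_ord0 ?addr0.
  + move=> _ _ [Z [m [c [A [B [ZC cC ->]]]]]] [Z' [m' [c' [A' [B' [ZC' cC' ->]]]]]].
    (* Sums are added by concatenating their index families. *)
    pose glue T (f : 'I_m -> T) (g : 'I_m' -> T) (i : 'I_(m + m')) :=
      match split i with inl j => f j | inr j => g j end.
    exists (Z + Z'), (m + m')%N, (glue _ c c'), (glue _ A A'), (glue _ B B').
    split=> [X|i|]; first by rewrite mulrDl mulrDr ZC ZC'.
      by rewrite /glue; case: split.
    rewrite big_split_ord addrACA; congr (_ + (_ + _)); apply: eq_bigr => i _.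
      by rewrite /glue (unsplitK (inl i)).
    by rewrite /glue (unsplitK (inr i)).
  + move=> a _ ca [Z [m [c [A [B [ZC cC ->]]]]]].
    exists (a *: Z), m, (fun i => a * c i), A, B; split=> [X|i|].
    * by rewrite mx_scaleAr_central // -scalerAl ZC.
    * exact: centralM.
    by rewrite scalerDr scaler_sumr; congr (_ + _); apply: eq_bigr => i _; rewrite scalerA.
- move=> Z ZC; exists Z, 0%N, (fun=> 0), (fun=> 0), (fun=> 0).
  by split=> // [[]|]; rewrite ?big_ord0 ?addr0.
move=> A B; exists 0, 1%N, (fun=> 1), (fun=> A), (fun=> B); split=> [X|i|].
- by rewrite mul0r mulr0.
- exact: central1.
by rewrite big_ord1 scale1r add0r.
Qed.
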